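(* Let $k \ge 1$ and $n$ be integers with $n \ge 2k^2$. If $\mathcal{A}, \mathcal{B} \subset \binom{[n]}{k}$ are two disjoint cross-intersecting families, then $$\min\{|\mathcal{A}|, |\mathcal{B}|\} \le \frac{1}{2} \binom{n-1}{k-1}.$$
   Context: $[n]=\{1,\dots,n\}$ and $\binom{[n]}{k}$ denotes the family of all $k$-element subsets of $[n]$. Two families $\mathcal{A},\mathcal{B}$ of sets are cross-intersecting if $A \cap B \neq \emptyset$ for every $A \in \mathcal{A}$ and every $B \in \mathcal{B}$. They are disjoint if no set belongs to both families, i.e. $\mathcal{A}\cap\mathcal{B}=\emptyset$. *)

(* Defs.v *)
From mathcomp Require Import all_boot all_order all_algebra.

Set Implicit Arguments.
Unset Strict Implicit.
Unset Printing Implicit Defensive.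

(* The ground set {1, ..., n} is represented by 'I_n = {0, ..., n-1}. *)
Definition ksubsets (n k : nat) : {set {set 'I_n}} :=
  [set X : {set 'I_n} | #|X| == k].

Definition cross_intersecting (T : finType) (A B : {set {set T}}) : Prop :=
  forall X Y : {set T}, X \in A -> Y \in B -> X :&: Y <> set0.

(* Main.v *)
Require Import Defs.
From mathcomp Require Import all_boot all_order all_algebra.
From mathcomp Require Import zify ring lra.

Set Implicit Arguments.
Unset Strict Implicit.
Unset Printing Implicit Defensive.

(** Let w_j be the number of k-sets containing a given j-set, so that w_1 is
the binomial coefficient of the theorem. The hypothesis n >= 2k^2 is used in
one form only: 2(k + j) w_(j+1) <= w_j ([supercard_step]). Thus prescribing one
more element, even with k choices for it, at least halves the count.

Let t be the least size of a set that meets every member of A or every member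
of B (a cover), and say that C, of size t, covers A. If a partial choice S of
fewer than t elements is made, some member of B misses S, and every member of
A must meet it: this offers k ways to extend S. Branching t - |S| times shows
that at most k^(t-|S|) w_t members of A contain S, and symmetrically for B
([card_branching], [degree_le]).

Suppose that no element x of C lies in a t-cover of B. Then one further
branching step is possible from each x, so A, being covered by C, has at most
t k^t w_(t+1) <= (t / 2^t) w_1 <= w_1 / 2 members.

Otherwise some x lies both in C and in a t-cover U of B. If t = 1, all members
of A and B contain x, and as A and B are disjoint, |A| + |B| <= w_1. If
t >= 2, it is shown that the members of A through x and the members of B
avoiding x number together at most w_1 / 2 ([star_costar_le_half]); adding the
same bound with A and B exchanged gives |A| + |B| <= w_1 again. To prove
it, take u in U other than x, and compare the members of A that contain x but
not u with the members of B that contain u but not x. These meet outside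
{x, u}. If one of the two families has no small cover outside {x, u}, the
other is half the size given by branching; if it has one, it is itself smaller
by a factor of order k. Either way enough is saved on the trivial
bound, which sums the t stars (that of x in A, those of the other elements of
U in B). *)

(** * Covers, stars and links *)

Definition covers (T : finType) (C : {set T}) (F : {set {set T}}) : bool :=
  [forall Y in F, C :&: Y != set0].

Definition star (T : finType) (x : T) (F : {set {set T}}) : {set {set T}} :=
  [set X in F | x \in X].

Definition costar (T : finType) (x : T) (F : {set {set T}}) : {set {set T}} :=
  [set X in F | x \notin X].

Definition link (T : finType) (x : T) (F : {set {set T}}) : {set {set T}} :=
  [set X :\ x | X in star x F].

(** For j <= k <= n this is the binomial coefficient of n - j over k - j,
written by complementation so that, for k < n, it vanishes when k < j. *)
Definition supercard (n k j : nat) : nat := 'C(n - j, n - k).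

(** The number t is a common lower bound for the covers of A and of B; keeping
it a lower bound, and not the exact minimum, makes the notion symmetric. *)
Definition entangled (T : finType) (k t : nat) (A B : {set {set T}}) : Prop :=
  [/\ forall X, X \in A -> #|X| = k, forall Y, Y \in B -> #|Y| = k,
      cross_intersecting A B,
      forall C, covers C A -> t <= #|C| & forall C, covers C B -> t <= #|C| ].

Lemma coversP (T : finType) (C : {set T}) (F : {set {set T}}) :
  reflect (forall X, X \in F -> exists2 y, y \in C & y \in X) (covers C F).
Proof.
apply: (iffP forall_inP) => h X /h.
  by case/set0Pn => y; rewrite inE => /andP[? ?]; exists y.
by case=> y yC yX; apply/set0Pn; exists y; rewrite inE yC.
Qed.

Lemma coversPn (T : finType) (C : {set T}) (F : {set {set T}}) :
  ~~ covers C F -> exists2 Y, Y \in F & forall y, y \in C -> y \notin Y.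
Proof.
case/forall_inPn => Y YF; rewrite negbK => /eqP CY0; exists Y => // y yC.
by apply/negP => yY; move: (in_set0 y); rewrite -CY0 inE yC yY.
Qed.

Lemma cross_meet (T : finType) (A B : {set {set T}}) (X Y : {set T}) :
  cross_intersecting A B -> X \in A -> Y \in B ->
  exists2 y, y \in Y & y \in X.
Proof.
move=> h XA YB; have /eqP/set0Pn[y] := h X Y XA YB.
by rewrite inE => /andP[? ?]; exists y.
Qed.

Lemma entangledC (T : finType) k t (A B : {set {set T}}) :
  entangled k t A B -> entangled k t B A.
Proof. by case=> ? ? h ? ?; split=> // X Y XB YA; rewrite setIC; apply: h. Qed.

Lemma card_star_costar (T : finType) (x : T) (F : {set {set T}}) :
  #|F| = #|star x F| + #|costar x F|.
Proof.
rewrite -(cardsID [set X : {set T} | x \in X] F).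
congr (_ + _); apply: eq_card => X.
  by rewrite !inE.
by rewrite !inE andbC.
Qed.

(** Count the pairs of an element of C and a member of F containing it. *)
Lemma card_covered_le (T : finType) (C : {set T}) (F : {set {set T}}) :
  covers C F -> #|F| <= \sum_(y in C) #|star y F|.
Proof.
move/coversP => h; have -> : \sum_(y in C) #|star y F| =
    \sum_(X in F) \sum_(y in C | y \in X) 1.
  rewrite (exchange_big_dep [in C]) //=; last by move=> X y _ /andP[].
  apply: eq_bigr => y yC; rewrite -sum1_card; apply: eq_bigl => X.
  by rewrite inE yC.
rewrite -sum1_card; apply: leq_sum => X /h[y yC yX].
by rewrite (bigD1 y) ?yC.
Qed.

Lemma card_covered_le_const (T : finType) (C : {set T}) (F : {set {set T}}) b :
  covers C F -> (forall y, y \in C -> #|star y F| <= b) -> #|F| <= #|C| * b.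
Proof.
move=> /card_covered_le h hb; apply: (leq_trans h).
by rewrite -sum_nat_const; apply: leq_sum.
Qed.

(** * Counting the supersets of a set *)

(** Complements of the members are subsets of the complement of S. *)
Lemma card_supersets (T : finType) k (S : {set T}) (F : {set {set T}}) :
  (forall X, X \in F -> #|X| = k) -> (forall X, X \in F -> S \subset X) ->
  #|F| <= supercard #|T| k #|S|.
Proof.
move=> Fk FS; have -> : supercard #|T| k #|S| = 'C(#|~: S|, #|T| - k).
  by rewrite /supercard -(cardsC S) addKn.
rewrite -cards_draws -(card_imset [in F] (@setC_inj T)); apply: subset_leq_card.
apply/subsetP => _ /imsetP[X XF ->]; rewrite inE setCS FS //=.
by rewrite -(Fk X XF) -(cardsC X) addKn.
Qed.

(** From (n - j) w_(j+1) = (k - j) w_j, since 2(k + j)(k - j) <= 2k^2 - j. *)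
Lemma supercard_step n k j : 0 < k -> 2 * k ^ 2 <= n ->
  2 * (k + j) * supercard n k j.+1 <= supercard n k j.
Proof.
move=> k0 hn; rewrite /supercard; have kn : k < n by nia.
have [nj|jn] := leqP n j.
  rewrite (_ : n - j.+1 = 0); last by lia.
  by rewrite bin0n (_ : (n - k == 0) = false) ?muln0 //; apply/eqP; lia.
have rec : (n - j) * 'C(n - j.+1, n - k) = (k - j) * 'C(n - j, n - k).
  by rewrite subnS mul_bin_down; congr (_ * _); lia.
rewrite -(leq_pmul2l (_ : 0 < n - j)) ?subn_gt0 // mulnCA rec mulnA.
by apply: leq_mul => //; nia.
Qed.

Lemma supercard_steps n k i j : 0 < k -> 2 * k ^ 2 <= n ->
  (2 * k) ^ i * supercard n k (i + j) <= supercard n k j.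
Proof.
move=> k0 hn; elim: i => [|i IHi]; first by rewrite mul1n.
apply: leq_trans IHi; rewrite expnSr -mulnA leq_mul2l; apply/orP; right.
apply: leq_trans (supercard_step (i + j) k0 hn).
by rewrite addSn leq_mul2r leq_mul2l leq_addr !orbT.
Qed.

(** * Branching *)

(** As long as S does not cover Q, a member Y of Q disjoint from S splits H
into at most k subfamilies according to an element of Y, which then joins S. *)
Lemma card_branching (T : finType) k i (H Q : {set {set T}}) (S : {set T}) :
  (forall X, X \in H -> #|X| = k) -> (forall Y, Y \in Q -> #|Y| <= k) ->
  cross_intersecting H Q -> (forall X, X \in H -> S \subset X) ->
  (forall C : {set T}, S \subset C -> covers C Q -> #|S| + i <= #|C|) ->
  #|H| <= k ^ i * supercard #|T| k (#|S| + i).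
Proof.
elim: i H S => [|i IHi] H S Hk Qk HQ HS nocov.
  by rewrite mul1n addn0; apply: card_supersets.
have /coversPn[Y YQ SY] : ~~ covers S Q.
  by apply/negP => /(nocov _ (subxx _)); lia.
have YH : covers Y H.
  by apply/coversP => X XH; have [y] := cross_meet HQ XH YQ; exists y.
apply: leq_trans (card_covered_le_const
  (b := k ^ i * supercard #|T| k (#|S| + i.+1)) YH _) _; last first.
  by rewrite expnS -mulnA leq_mul2r Qk ?orbT.
move=> y yY; have cS : #|y |: S| = #|S|.+1.
  by rewrite cardsU1 (_ : y \notin S) //; apply/negP => /SY /negP.
rewrite addnS -addSn -cS; apply: IHi => //.
- by move=> X; rewrite inE => /andP[/Hk].
- by move=> X Z; rewrite inE => /andP[XH _]; apply: HQ.
- by move=> X; rewrite inE subUset sub1set => /andP[/HS -> ->].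
- move=> C; rewrite subUset => /andP[_ SC] /(nocov _ SC).
  by rewrite cS addnS.
Qed.

Lemma degree_le (T : finType) k t (A B H : {set {set T}}) (S : {set T}) :
  entangled k t A B -> H \subset A -> (forall X, X \in H -> S \subset X) ->
  #|S| <= t -> #|H| <= k ^ (t - #|S|) * supercard #|T| k t.
Proof.
case=> Ak Bk AB _ tB /subsetP HA HS St.
rewrite -[in supercard _ _ _](subnKC St).
apply: (card_branching (Q := B)) => //.
- by move=> X /HA /Ak.
- by move=> Y /Bk ->.
- by move=> X Y /HA; apply: AB.
- by move=> C _ /tB; rewrite subnKC.
Qed.

Lemma star_le (T : finType) k t (A B : {set {set T}}) x :
  entangled k t.+1 A B -> #|star x A| <= k ^ t * supercard #|T| k t.+1.
Proof.
move=> AB; have := @degree_le _ _ _ _ _ (star x A) [set x] AB.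
rewrite cards1 subn1; apply=> // [|X].
  by apply/subsetP => X; rewrite inE => /andP[].
by rewrite sub1set inE => /andP[].
Qed.

Lemma pair_star_le (T : finType) k r (A B : {set {set T}}) x y :
  entangled k r.+2 A B -> x != y ->
  #|star y (star x A)| <= k ^ r * supercard #|T| k r.+2.
Proof.
move=> AB xy; have := @degree_le _ _ _ _ _ (star y (star x A)) [set x; y] AB.
rewrite cards2 xy subn2; apply=> //.
  by apply/subsetP => X; rewrite !inE => /andP[/andP[]].
by move=> X; rewrite !inE subUset !sub1set => /andP[/andP[_ ->] ->].
Qed.

(** * Comparing the two families at a pair of elements *)

(** The members of B containing u but not x meet every member of the link of x
in A. Branching from {u} over this link succeeds t times, one more than over
A, which yields half the usual bound. *)
Lemma card_star_uncovered_link (T : finType) k t (A B : {set {set T}}) x u :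
  entangled k t A B ->
  (forall C : {set T}, u \in C -> covers C (link x A) -> t < #|C|) ->
  #|star u (costar x B)| <= k ^ t * supercard #|T| k t.+1.
Proof.
case=> Ak Bk AB _ _ nocov; rewrite -add1n -(cards1 u).
apply: (card_branching (Q := link x A)).
- by move=> Y; rewrite !inE => /andP[/andP[/Bk]].
- move=> _ /imsetP[X + ->]; rewrite inE => /andP[/Ak <- _].
  by rewrite subset_leq_card ?subD1set.
- move=> Y _ + /imsetP[X + ->]; rewrite !inE.
  move=> /andP[/andP[YB xY] _] /andP[XA _].
  have [y yY yX] := cross_meet AB XA YB.
  by apply/eqP/set0Pn; exists y; rewrite !inE yY yX (memPn xY) ?andbT.
- by move=> Y; rewrite sub1set inE => /andP[].
- by move=> C; rewrite sub1set cards1 => uC /(nocov _ uC).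
Qed.

(** A member of A that contains x but not u meets C outside {x, u}, hence
contains one of at most r + 1 given pairs. *)
Lemma card_star_covered_link (T : finType) k r (A B : {set {set T}}) x u
    (C : {set T}) :
  entangled k r.+2 A B -> u \in C -> #|C| <= r.+2 -> covers C (link x A) ->
  #|star x (costar u A)| <= r.+1 * (k ^ r * supercard #|T| k r.+2).
Proof.
move=> AB uC Cr /coversP hC.
apply: leq_trans (card_covered_le_const (C := C :\ u :\ x)
   (b := k ^ r * supercard #|T| k r.+2) _ _) _.
- apply/coversP => X; rewrite !inE => /andP[/andP[XA uX] xX].
  have [|y yC] := hC (X :\ x); first by apply: imset_f; rewrite inE XA.
  rewrite !inE => /andP[yx yX]; exists y => //; rewrite !inE yx yC andbT.
  by apply: contraNneq uX => <-.
- move=> y; rewrite !inE => /andP[yx _].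
  apply: leq_trans (pair_star_le (y := y) AB (_ : x != y)); last first.
    by rewrite eq_sym.
  apply: subset_leq_card; apply/subsetP => X; rewrite !inE.
  by case/andP => /andP[/andP[-> _] ->] ->.
- rewrite leq_mul2r; apply/orP; right.
  apply: (@leq_trans #|C :\ u|); first by rewrite subset_leq_card ?subD1set.
  by move: Cr; rewrite (cardsD1 u C) uC.
Qed.

(** A member X of A containing x but not u serves as a first branching step
with only k - 1 choices for the members of B that avoid x. Gaining one choice
out of k is essential when r = 0, where the estimates of
[star_costar_le_half] are tightest. *)
Lemma pair_dichotomy (T : finType) k r (A B : {set {set T}}) x u :
  entangled k r.+2 A B -> x != u ->
  star x (costar u A) = set0 \/
  #|star u (costar x B)| <= k.-1 * (k ^ r * supercard #|T| k r.+2).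
Proof.
move=> AB xu; case: (set_0Vmem (star x (costar u A))) => [|[X]]; first by left.
rewrite !inE => /andP[/andP[XA uX] xX]; right; case: (AB) => Ak _ cAB _ _.
have -> : k.-1 = #|X :\ x| by rewrite -(Ak X XA) (cardsD1 x X) xX.
apply: card_covered_le_const => [|y].
  apply/coversP => Y; rewrite !inE => /andP[/andP[YB xY] uY].
  have [y yY yX] := cross_meet cAB XA YB; exists y => //.
  by rewrite !inE yX (memPn xY).
rewrite !inE => /andP[yx yX].
apply: leq_trans (pair_star_le (y := y) (entangledC AB) (_ : u != y));
  last first.
  by rewrite eq_sym (memPn uX).
apply: subset_leq_card; apply/subsetP => Y; rewrite !inE.
by case/andP => /andP[/andP[-> _] ->] ->.
Qed.

Lemma star_split (T : finType) k r (A B : {set {set T}}) x u :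
  entangled k r.+2 A B -> x != u ->
  #|star x A| <= k ^ r * supercard #|T| k r.+2 + #|star x (costar u A)|.
Proof.
move=> AB xu; rewrite (card_star_costar u (star x A)) leq_add //.
  exact: pair_star_le AB xu.
by apply: subset_leq_card; apply/subsetP => X; rewrite !inE andbAC.
Qed.

Lemma costar_split (T : finType) (B : {set {set T}}) x u (U : {set T}) b r :
  covers U B -> x \in U -> u \in U -> x != u -> #|U| <= r.+2 ->
  (forall v, v \in U -> v != x -> #|star v (costar x B)| <= b) ->
  #|costar x B| <= #|star u (costar x B)| + r * b.
Proof.
move=> /coversP hU xU uU xu Ur hb.
have cov : covers (U :\ x) (costar x B).
  apply/coversP => Y; rewrite inE => /andP[YB xY].
  by have [y yU yY] := hU Y YB; exists y => //; rewrite !inE yU (memPn xY).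
apply: (leq_trans (card_covered_le cov)).
have uU' : u \in U :\ x by rewrite !inE eq_sym xu.
rewrite (bigD1 u) //= leq_add2l.
apply: (@leq_trans (\sum_(v in U :\ x :\ u) b)); last first.
  rewrite sum_nat_const leq_mul2r; apply/orP; right.
  by move: Ur; rewrite (cardsD1 x U) xU (cardsD1 u) uU'.
rewrite [leqRHS](eq_bigl (fun v => (v \in U :\ x) && (v != u))); last first.
  by move=> v; rewrite !inE andbC.
by apply: leq_sum => v; rewrite !inE => /andP[/andP[vx vU] _]; apply: hb.
Qed.

(** * The bound *)

(** With p = k^r w_(r+2), each of the r + 2 stars involved has at most k p
members, whereas w_1 / 2 >= 2^r (k + r + 1) p: the factor k + r + 1 in place
of k, which comes from [supercard_step], absorbs the terms of lower order.
Either the star of x in A turns out to be of order p, or all the stars of B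
can be halved. *)
Lemma star_costar_le_half (T : finType) k r (A B : {set {set T}}) x
    (U : {set T}) :
  0 < k -> 2 * k ^ 2 <= #|T| -> entangled k r.+2 A B ->
  covers U B -> x \in U -> #|U| = r.+2 ->
  2 * (#|star x A| + #|costar x B|) <= supercard #|T| k 1.
Proof.
move=> k0 hn AB covU xU Ur.
set p := k ^ r * supercard #|T| k r.+2.
(* The last of the factors 2(k + j) is kept exact, the others are replaced
   by 2k. *)
suff main : #|star x A| + #|costar x B| <= 2 ^ r * (k + r.+1) * p.
  have := supercard_steps r 1 k0 hn; have := supercard_step r.+1 k0 hn.
  rewrite addn1; move: main; rewrite /p expnMn.
  move: (supercard _ _ r.+1) (supercard _ _ r.+2) (supercard _ _ 1) => a b c.
  move=> h1 h2 h3; apply: leq_trans h3.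
  apply: leq_trans (leq_mul (leqnn _) h1) _.
  apply: leq_trans (leq_mul (leqnn _) h2).
  by apply: eq_leq; ring.
have two_r : r.+1 <= 2 ^ r by apply: ltn_expl.
have G_le v : #|star v (costar x B)| <= k * p.
  rewrite /p mulnA -expnS; apply: leq_trans (star_le v (entangledC AB)).
  apply: subset_leq_card; apply/subsetP => Y.
  by rewrite !inE => /andP[/andP[-> _] ->].
have split u b : u \in U -> x != u ->
    (forall v, v \in U -> v != x -> #|star v (costar x B)| <= b) ->
    #|costar x B| <= #|star u (costar x B)| + r * b.
  by move=> uU xu; apply: costar_split; rewrite ?Ur.
pose small (F : {set {set T}}) y z :=
  [exists C : {set T}, [&& z \in C, #|C| <= r.+2 & covers C (link y F)]].
have smallP F F' y z : entangled k r.+2 F F' -> small F y z ->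
    #|star y (costar z F)| <= r.+1 * p.
  by move=> FF' /existsP[C /and3P[]]; apply: (card_star_covered_link FF').
have smallN F F' y z : entangled k r.+2 F F' -> ~~ small F y z ->
    2 * #|star z (costar y F')| <= k * p.
  move=> FF' /existsPn h.
  have hstar : #|star z (costar y F')| <= k ^ r.+2 * supercard #|T| k r.+3.
    apply: card_star_uncovered_link FF' _ => C zC cC; have := h C.
    by rewrite zC cC andbT ltnNge.
  apply: leq_trans (leq_mul (leqnn 2) hstar) _.
  have := supercard_steps 1 r.+2 k0 hn; rewrite expn1 add1n.
  move=> /(leq_mul (leqnn (k ^ r.+1))) => h'.
  rewrite /p [k * _]mulnA -expnS; apply: leq_trans h'.
  by apply: eq_leq; rewrite !expnS; ring.
(* For some u in U, only O(p) members of A contain x. *)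
have [/exists_inP[u uU /andP[xu sm]]|/exists_inPn none] :=
    boolP [exists u in U, (x != u) && small A x u].
  have hB := split u _ uU xu (fun v _ _ => G_le v).
  have hA := star_split AB xu; have hs := smallP _ _ _ _ AB sm.
  apply: (@leq_trans (r.+1 * (k + r.+1) * p)); last first.
    by rewrite !leq_mul2r two_r !orbT.
  case: (pair_dichotomy AB xu) => [e0|hG].
    move: hA hB (G_le u); rewrite e0 cards0 -/p; nia.
  by move: hA hB hG hs; rewrite -/p; nia.
(* From here on every star of B counted has at most k p / 2 members. *)
have [u /setD1P[]] : exists u, u \in U :\ x.
  by apply/set0Pn; rewrite -card_gt0; move: Ur; rewrite (cardsD1 x U) xU; lia.
rewrite eq_sym => xu uU.
have hG v : v \in U -> v != x -> 2 * #|star v (costar x B)| <= k * p.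
  move=> vU vx; apply: smallN AB _.
  by have := none v vU; rewrite eq_sym vx.
have {}hG v : v \in U -> v != x -> #|star v (costar x B)| <= (k * p)./2.
  by move=> vU vx; have := hG v vU vx; lia.
have hB := split u _ uU xu hG; have hGu := hG u uU; rewrite eq_sym xu in hGu.
have hA := star_split AB xu; rewrite -/p in hA.
have hF : #|star x A| <= k * p by rewrite /p mulnA -expnS; apply: star_le AB.
have half2 : 2 * (k * p)./2 <= k * p by lia.
suff twice : 2 * (#|star x A| + #|costar x B|) <=
             (r.+2 * k + 2 * r.+1) * p.
  rewrite -(leq_pmul2l (isT : 0 < 2)); apply: (leq_trans twice).
  rewrite mulnA leq_mul2r; apply/orP; right.
  by move: (2 ^ r) two_r => q; nia.
have hrb : 2 * (r * (k * p)./2) <= r * (k * p).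
  by rewrite mulnCA leq_mul2l half2 orbT.
move: hB hGu hA half2 hrb; move: (k * p)./2 => b.
(* Halving the stars of B alone gives (r + 3) k p / 2, too much when r = 0; so
   one more star, that of u in B or that of x in A, is improved. *)
have [sm|big] := boolP (small B u x).
  by have := smallP _ _ _ _ (entangledC AB) sm; nia.
by have := smallN _ _ _ _ (entangledC AB) big; nia.
Qed.

Lemma minn_card_le_half (T : finType) k t (A B : {set {set T}}) (C : {set T}) :
  0 < k -> 2 * k ^ 2 <= #|T| -> A :&: B = set0 -> entangled k t A B ->
  covers C A -> #|C| = t -> 2 * minn #|A| #|B| <= supercard #|T| k 1.
Proof.
move=> k0 hn dAB AB covC Ct.
have [/exists_inP[x xC /existsP[U /and3P[xU /eqP Ut covU]]]|/exists_inPn none] :=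
  boolP [exists x in C, exists U : {set T},
           [&& x \in U, #|U| == t & covers U B]].
  suff : #|A| + #|B| <= supercard #|T| k 1 by lia.
  case: t => [|[|r]] in AB Ct Ut *.
  - by move: xC; rewrite (cards0_eq Ct) inE.
  - have -> : #|A| + #|B| = #|A :|: B| by rewrite cardsU dAB cards0 subn0.
    rewrite -(cards1 x); case: AB => Ak Bk _ _ _.
    have sub1 (D : {set T}) F : x \in D -> #|D| = 1 -> covers D F ->
        forall X, X \in F -> x \in X.
      move=> xD /eqP/cards1P[y Dy] /coversP h X /h[z]; move: xD.
      by rewrite Dy !inE => /eqP -> /eqP ->.
    apply: card_supersets => X /setUP[].
    + exact: Ak.
    + exact: Bk.
    + by rewrite sub1set; apply: sub1 xC Ct covC _.
    + by rewrite sub1set; apply: sub1 xU Ut covU _.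
  - have := star_costar_le_half k0 hn AB covU xU Ut.
    have := star_costar_le_half k0 hn (entangledC AB) covC xC Ct.
    by rewrite (card_star_costar x A) (card_star_costar x B); lia.
suff : 2 * #|A| <= supercard #|T| k 1 by lia.
have hA : #|A| <= t * (k ^ t * supercard #|T| k t.+1).
  rewrite -Ct; apply: card_covered_le_const => // x xC; rewrite Ct.
  rewrite -add1n -(cards1 x); case: AB => Ak Bk cAB _ tB.
  apply: (card_branching (Q := B)).
  - by move=> X; rewrite inE => /andP[/Ak].
  - by move=> Y /Bk ->.
  - by move=> X Y; rewrite inE => /andP[XA _]; apply: cAB.
  - by move=> X; rewrite inE sub1set => /andP[].
  - move=> D; rewrite sub1set cards1 => xD covD.
    have /existsPn/(_ D) := none x xC.
    by rewrite xD covD andbT ltn_neqAle tB // andbT eq_sym.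
apply: leq_trans (leq_mul (leqnn 2) hA) _.
have h := supercard_steps t 1 k0 hn; rewrite addn1 in h; apply: leq_trans h.
rewrite mulnA [leqRHS](_ : _ = 2 ^ t * (k ^ t * supercard #|T| k t.+1)).
  rewrite leq_mul2r; apply/orP; right; case: (t) => // t'.
  by rewrite expnS leq_mul2l ltn_expl.
by rewrite expnMn mulnA.
Qed.

Theorem theorem1p1 (n k : nat) (A B : {set {set 'I_n}})
    (hk : (1 <= k)%N) (hn : (2 * k ^ 2 <= n)%N)
    (hA : A \subset ksubsets n k) (hB : B \subset ksubsets n k)
    (hdisj : A :&: B = set0) (hcross : cross_intersecting A B) :
  ((minn #|A| #|B|)%:R <= 1 / 2 * ('C(n - 1, k - 1))%:R :> rat)%R.
Proof.
suff main : 2 * minn #|A| #|B| <= 'C(n - 1, k - 1).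
  have : ((2 * minn #|A| #|B|)%:R <= ('C(n - 1, k - 1))%:R :> rat)%R.
    by rewrite Num.Theory.ler_nat.
  by rewrite GRing.natrM; lra.
have [->|[Y0 Y0B]] := set_0Vmem B; first by rewrite cards0 minn0.
have kn : k <= n by nia.
have -> : 'C(n - 1, k - 1) = supercard #|'I_n| k 1.
  rewrite /supercard card_ord -(bin_sub (_ : k - 1 <= n - 1)); last by lia.
  by congr 'C(_, _); lia.
have Ak X : X \in A -> #|X| = k by move/(subsetP hA); rewrite inE => /eqP.
have Bk Y : Y \in B -> #|Y| = k by move/(subsetP hB); rewrite inE => /eqP.
have hn' : 2 * k ^ 2 <= #|'I_n| by rewrite card_ord.
have covY0 : covers Y0 A.
  apply/coversP => X XA; have [y yY yX] := cross_meet hcross XA Y0B.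
  by exists y.
case: (@arg_minnP _ Y0 (fun C => covers C A || covers C B) (fun C => #|C|)).
  by rewrite covY0.
move=> C hC Cmin.
have AB : entangled k #|C| A B.
  by split=> // D cD; apply: Cmin; rewrite cD ?orbT.
case/orP: hC => hC; first exact: minn_card_le_half hk hn' hdisj AB hC erefl.
rewrite minnC; apply: minn_card_le_half hk hn' _ (entangledC AB) hC erefl.
by rewrite setIC.
Qed.
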